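(* The Discrete Fourier Transform of a vector with $n$ entries can be computed in the $(m,\ell)$-TCU model in time $$T(n)=O\big((n+\ell)\log_m n\big).$$
   Context: The DFT of an $n$-dimensional column vector $x$ is $y=x^T W$, where $W$ is the $n\times n$ matrix with $W_{r,c}=e^{-(2\pi i/n)rc}$. It is assumed that the TCU model operates on complex numbers (arithmetic and tensor-unit products), and that the quantities arising from recursively splitting $n$ into factors $\sqrt{m}$ and $n/\sqrt{m}$ are integers. The $(m,\ell)$-TCU model (parameters $m\ge 1$, $\ell\ge 0$) is the standard RAM model whose CPU additionally contains a tensor unit: by a constant-size instruction specifying the memory addresses of the operands and of the output, the unit multiplies an $N\times\sqrt{m}$ matrix by a $\sqrt{m}\times\sqrt{m}$ matrix (where $N\geq\sqrt{m}$ is chosen by the algorithm) and writes the product to memory, at a cost of $O(N\sqrt{m}+\ell)$ time. The running time of an algorithm is the total cost of all operations performed, including all calls to the tensor unit.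
   Formalization: The bound is proved for m > 1 and n ≥ m (at n = 1 it would be 0, and for n fixed it tends to 0 as m grows), with √m an integer, and the root e^{-2πi/n} is supplied with the input as one constant, since complex arithmetic alone cannot produce it. *)

(* Defs.v *)
From mathcomp Require Import all_boot all_order all_algebra.
From mathcomp Require Import reals.
From mathcomp Require Import sequences exp trigo.
From mathcomp Require Export complex.

Set Implicit Arguments.
Unset Strict Implicit.
Unset Printing Implicit Defensive.

Import Order.TTheory GRing.Theory Num.Theory.
Local Open Scope ring_scope.

Definition cexp {R : realType} (z : R[i]) : R[i] :=
  let: (a +i* b)%C := z in (expR a * cos b +i* (expR a * sin b))%C.

Definition fourier_mx (R : realType) (n : nat) : 'M[R[i]]_n :=
  \matrix_(r < n, c < n)
    cexp (- (2 * (pi : R)%:C%C * 'i%C / n%:R) * (r * c)%N%:R).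

Definition dft {R : realType} {n : nat} (x : 'cV[R[i]]_n) : 'rV[R[i]]_n :=
  x^T *m fourier_mx R n.

Definition logb {R : realType} (b x : R) : R := ln x / ln b.

(* n may be split recursively as sqrt(m) * (n / sqrt(m)), with s = sqrt(m) and
   all quotients integers, until a single s x s product can handle the
   remaining factor. *)
Inductive splittable (s : nat) : nat -> Prop :=
| splittable_base n : (0 < n <= s)%N -> splittable s n
| splittable_step n :
    (s < n)%N -> (s %| n)%N -> splittable s (n %/ s) -> splittable s n.

(* The RAM has two unbounded memories: integer cells I[0], I[1], ... (natural
   numbers, used for counters and addresses) and complex cells Z[0], Z[1], ...
   An operand of an I-instruction is the index of an integer cell; an operand
   of a Z-instruction is the index of an integer cell that holds the address of
   the complex cell meant. *)
Inductive instr : Type :=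
| IConst of nat & nat            (* I[d] := k *)
| IAdd of nat & nat & nat        (* I[d] := I[a] + I[b] *)
| ISub of nat & nat & nat        (* I[d] := I[a] - I[b], truncated at 0 *)
| IMul of nat & nat & nat        (* I[d] := I[a] * I[b] *)
| IDiv of nat & nat & nat        (* I[d] := I[a] / I[b], rounded down *)
| ILoad of nat & nat             (* I[d] := I[I[a]] *)
| IStore of nat & nat            (* I[I[d]] := I[a] *)
| Jump of nat                    (* goto k *)
| JumpIZ of nat & nat            (* if I[a] = 0 goto k *)
| JumpZZ of nat & nat            (* if Z[I[a]] = 0 goto k *)
| ZConst of nat & nat            (* Z[I[d]] := k *)
| ZMove of nat & nat             (* Z[I[d]] := Z[I[a]] *)
| ZAdd of nat & nat & nat        (* Z[I[d]] := Z[I[a]] + Z[I[b]] *)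
| ZSub of nat & nat & nat        (* Z[I[d]] := Z[I[a]] - Z[I[b]] *)
| ZMul of nat & nat & nat        (* Z[I[d]] := Z[I[a]] * Z[I[b]] *)
| ZDiv of nat & nat & nat        (* Z[I[d]] := Z[I[a]] / Z[I[b]] *)
| Tensor of nat & nat & nat & nat
    (* Tensor d a b k: the I[k] x s matrix stored at address I[a] times the
       s x s matrix stored at address I[b], written at address I[d] *)
| Halt.

Definition program := seq instr.

Record state (R : realType) := State {
  pc : nat;
  imem : nat -> nat;
  zmem : nat -> R[i]
}.

Definition upd {T : Type} (f : nat -> T) (k : nat) (v : T) : nat -> T :=
  fun j => if j == k then v else f j.

(* Matrices are stored contiguously in row-major order. *)
Definition read_mx {T : Type} (z : nat -> T) (a p q : nat) : 'M[T]_(p, q) :=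
  \matrix_(i < p, j < q) z (a + i * q + j)%N.

Definition write_mx {T : Type} {p q : nat} (z : nat -> T) (a : nat)
    (A : 'M[T]_(p, q)) : nat -> T :=
  fun k =>
    if (a <= k)%N then
      match insub ((k - a) %/ q)%N, insub ((k - a) %% q)%N with
      | Some i, Some j => A i j
      | _, _ => z k
      end
    else z k.

Definition fetch {R : realType} (P : program) (sg : state R) : instr :=
  nth Halt P (pc sg).

(* One step of the (m, l)-TCU with s = sqrt(m): the next state and the cost of
   the instruction. There is no step from Halt, nor from a call to the tensor
   unit on a left operand with fewer than s rows. *)
Definition step {R : realType} (s : nat) (l : R) (P : program) (sg : state R) :
    option (state R * R) :=
  let: State p im zm := sg in
  let iset d v := Some (State p.+1 (upd im d v) zm, 1) in
  let zset d v := Some (State p.+1 im (upd zm (im d) v), 1) in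
  let goto k := Some (State k im zm, 1) in
  match fetch P sg with
  | IConst d k => iset d k
  | IAdd d a b => iset d (im a + im b)%N
  | ISub d a b => iset d (im a - im b)%N
  | IMul d a b => iset d (im a * im b)%N
  | IDiv d a b => iset d (im a %/ im b)%N
  | ILoad d a => iset d (im (im a))
  | IStore d a => iset (im d) (im a)
  | Jump k => goto k
  | JumpIZ a k => goto (if im a == 0%N then k else p.+1)
  | JumpZZ a k => goto (if zm (im a) == 0 then k else p.+1)
  | ZConst d k => zset d k%:R
  | ZMove d a => zset d (zm (im a))
  | ZAdd d a b => zset d (zm (im a) + zm (im b))
  | ZSub d a b => zset d (zm (im a) - zm (im b))
  | ZMul d a b => zset d (zm (im a) * zm (im b))
  | ZDiv d a b => zset d (zm (im a) / zm (im b))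
  | Tensor d a b k =>
      if (s <= im k)%N then
        Some (State p.+1 im
                (write_mx zm (im d)
                   (read_mx zm (im a) (im k) s *m read_mx zm (im b) s s)),
              (im k * s)%:R + l)
      else None
  | Halt => None
  end.

(* runs s l P sg t sg': started in sg, the program halts in sg' after a run of
   total cost t. *)
Inductive runs {R : realType} (s : nat) (l : R) (P : program) :
    state R -> R -> state R -> Prop :=
| runs_halt sg : fetch P sg = Halt -> runs s l P sg 1 sg
| runs_step sg sg1 sg2 c t :
    step s l P sg = Some (sg1, c) -> runs s l P sg1 t sg2 ->
    runs s l P sg (c + t) sg2.

(* Input: I[0] = n, I[1] = s, Z[0..n-1] = x, and the constant
   Z[n] = e^(-2 pi i / n), which the complex arithmetic operations alone cannot
   produce; all other cells are 0. *)
Definition dft_input {R : realType} (s : nat) {n : nat} (x : 'cV[R[i]]_n) :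
    state R :=
  State 0
    (fun k => if k == 0%N then n else if k == 1%N then s else 0%N)
    (fun k => if insub k is Some j then x j ord0
              else if k == n then cexp (- (2 * (pi : R)%:C%C * 'i%C / n%:R))
              else 0).

Definition output_row {R : realType} (n : nat) (sg : state R) : 'rV[R[i]]_n :=
  \row_(j < n) zmem sg j.

(* Main.v *)
(* Write [n = L * M].  Let [y_M(k * M + p)], for [k < L] and [p < M], be the
   [k]-th entry of the DFT of length [L] of the inputs whose index is [p] modulo
   [M].  Then [y_n] is the input, [y_1] is its DFT, and for [M = f * M'] the
   vector [y_M'] arises from [y_M] by multiplying with twiddle factors,
   arranging the [n] entries as an [n / f] by [f] matrix, multiplying that matrix
   by the Fourier matrix of order [f] and transposing (Stockham's form of the
   fast Fourier transform, which needs no final reordering).  With [f = s] as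
   long as [M > s] and [f = M] at the end, each stage costs [O(n)] plus a single
   call to the tensor unit, and there are at most [1 + log_s n] stages.
   In the last stage [f] may be much smaller than [s]: padding the rows to length
   [s] would cost a factor [s / f], so [s / f] rows of length [f] are packed into
   one row of length [s] and multiplied by a block-diagonal matrix. *)

Require Import Defs.
From mathcomp Require Import all_boot all_order all_algebra.
From mathcomp Require Import reals complex exp trigo.
From mathcomp Require Import zify ring lra.

Set Implicit Arguments.
Unset Strict Implicit.
Unset Printing Implicit Defensive.

Import Order.TTheory GRing.Theory Num.Theory.
Local Open Scope ring_scope.

(** * Structured programs *)

(** The tensor call stands apart from [Block]: its cost depends on register contents, whereas a
    block costs exactly its length. *)
Inductive cmd :=
| Block of seq instr
| Call of nat & nat & nat & nat
| Seq of cmd & cmd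
| While of nat & cmd.

Fixpoint code_size (c : cmd) : nat :=
  match c with
  | Block b => size b
  | Call _ _ _ _ => 1
  | Seq c1 c2 => code_size c1 + code_size c2
  | While _ c => code_size c + 2
  end.

Fixpoint compile (p : nat) (c : cmd) : program :=
  match c with
  | Block b => b
  | Call d a b k => [:: Tensor d a b k]
  | Seq c1 c2 => compile p c1 ++ compile (p + code_size c1) c2
  | While r c =>
      JumpIZ r (p + (code_size c + 2)) :: rcons (compile p.+1 c) (Jump p)
  end.

Lemma size_compile p c : size (compile p c) = code_size c.
Proof.
elim: c p => //= [c1 IH1 c2 IH2|r c IH] p; first by rewrite size_cat IH1 IH2.
by rewrite size_rcons IH addn2.
Qed.

Definition code_at (P : program) (p : nat) (b : program) : Prop :=
  forall j, (j < size b)%N -> nth Halt P (p + j) = nth Halt b j.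

Lemma code_at_cat P p b1 b2 :
  code_at P p (b1 ++ b2) -> code_at P p b1 /\ code_at P (p + size b1) b2.
Proof.
move=> H; split=> j jb.
  by rewrite H ?size_cat ?ltn_addr// nth_cat jb.
by rewrite -addnA H ?size_cat ?ltn_add2l// nth_cat ltnNge leq_addr/= addKn.
Qed.

(** * Cost semantics of structured programs *)

Section Machine.
Variables (R : realType) (s : nat) (l : R).
Implicit Types (P : program) (sg : state R) (im : nat -> nat)
  (zm : nat -> R[i]) (Q : (nat -> nat) -> (nat -> R[i]) -> Prop).

(** Runs that need not halt, so that they compose; the unit that [runs] charges for [Halt] is left
    out. *)
Inductive reaches P : state R -> R -> state R -> Prop :=
| reaches_refl sg : reaches P sg 0 sg
| reaches_step sg sg1 sg2 c t :
    step s l P sg = Some (sg1, c) -> reaches P sg1 t sg2 ->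
    reaches P sg (c + t) sg2.

Lemma reaches_trans P sg1 sg2 sg3 t1 t2 :
  reaches P sg1 t1 sg2 -> reaches P sg2 t2 sg3 -> reaches P sg1 (t1 + t2) sg3.
Proof.
elim=> [sg|sg sg' sg'' c t st _ IH] H; first by rewrite add0r.
by rewrite -addrA; apply: reaches_step st (IH H).
Qed.

Lemma reaches1 P sg sg1 c :
  step s l P sg = Some (sg1, c) -> reaches P sg c sg1.
Proof. by move=> st; rewrite -[c]addr0; apply: reaches_step st (reaches_refl _ _). Qed.

Lemma reaches_runs P sg t sg' :
  reaches P sg t sg' -> fetch P sg' = Halt -> runs s l P sg (t + 1) sg'.
Proof.
elim=> [sg0|sg0 sg1 sg2 c t0 st _ IH] H; first by rewrite add0r; apply: runs_halt.
by rewrite -addrA; apply: runs_step st (IH H).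
Qed.

(* [triple c im zm B Q]: wherever the code of [c] is placed, running it from
   the memories [im], [zm] falls through to its end at a cost of at most [B],
   in memories that satisfy [Q]. *)
Definition triple (c : cmd) im zm (B : R) Q : Prop :=
  forall P p, code_at P p (compile p c) ->
  exists t im' zm',
    [/\ reaches P (State p im zm) t (State (p + code_size c) im' zm'),
        t <= B & Q im' zm'].

Lemma triple_weaken c im zm B B' Q Q' :
  triple c im zm B Q -> B <= B' -> (forall im' zm', Q im' zm' -> Q' im' zm') ->
  triple c im zm B' Q'.
Proof.
move=> H le QQ P p /H[t [im' [zm' [r tB q]]]].
by exists t, im', zm'; split=> //; [apply: le_trans tB le | apply: QQ].
Qed.

Lemma triple_seq c1 c2 im zm B1 B2 Q :
  triple c1 im zm B1 (fun im' zm' => triple c2 im' zm' B2 Q) ->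
  triple (Seq c1 c2) im zm (B1 + B2) Q.
Proof.
move=> H P p /= /code_at_cat[/H[t1 [im1 [zm1 [r1 tB1 H2]]]]].
rewrite size_compile => /H2[t2 [im2 [zm2 [r2 tB2 q]]]].
exists (t1 + t2), im2, zm2; split=> //; last exact: lerD.
by rewrite addnA; apply: reaches_trans r1 r2.
Qed.

Lemma triple_call d a b k im zm :
  (s <= im k)%N ->
  triple (Call d a b k) im zm ((im k * s)%:R + l) (fun im' zm' =>
    im' = im /\ zm' = write_mx zm (im d)
                   (read_mx zm (im a) (im k) s *m read_mx zm (im b) s s)).
Proof.
move=> sk P p /(_ 0%N isT)/=; rewrite addn0 => F.
eexists; eexists; eexists; split; [apply: reaches1 | exact: lexx | by []].
by rewrite /step/= /fetch/= F sk addn1.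
Qed.

Lemma triple_while_exit r c im zm Q :
  im r = 0%N -> Q im zm -> triple (While r c) im zm 1 Q.
Proof.
move=> r0 q P p /(_ 0%N isT)/=; rewrite addn0 => F.
exists 1, im, zm; split=> //; apply: reaches1.
by rewrite /step/= /fetch/= F r0.
Qed.

(** The body's postcondition is a triple for the loop itself, so invariants come from inductions
    outside the program logic. The 2 pays for the test and the jump back. *)
Lemma triple_while_next r c im zm B1 B2 Q :
  (0 < im r)%N ->
  triple c im zm B1 (fun im' zm' => triple (While r c) im' zm' B2 Q) ->
  triple (While r c) im zm (B1 + B2 + 2) Q.
Proof.
move=> r0 H P p W; have F0 := W 0%N isT; have Fn := W (code_size c).+1.
move: F0 Fn W; rewrite /= size_rcons size_compile addn0 => F0 /(_ (leqnn _)) Fn W.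
move: Fn; rewrite nth_rcons size_compile ltnn eqxx => Fn.
have Wc : code_at P p.+1 (compile p.+1 c).
  move=> j jb; have := W j.+1; rewrite /= size_rcons size_compile !ltnS addSnnS.
  rewrite size_compile in jb; rewrite ltnW// => ->//.
  by rewrite nth_rcons size_compile jb.
have [t1 [im1 [zm1 [r1 tB1 H2]]]] := H _ _ Wc.
have [|t2 [im2 [zm2 [r2 tB2 q]]]] := H2 P p.
  move=> j; rewrite /= size_rcons size_compile => jb.
  by apply: W; rewrite /= size_rcons size_compile.
exists (1 + (t1 + (1 + t2))), im2, zm2; split=> //; last by lra.
apply: (@reaches_step _ _ (State p.+1 im zm)).
  by rewrite /step/= /fetch/= F0 (gtn_eqF r0).
apply: reaches_trans r1 _; apply: reaches_step r2.
by rewrite /step/= /fetch/= addSnnS Fn.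
Qed.

(** Complex additions are absent: the transform performs them all inside the tensor unit. *)
Definition effect (i : instr) (st : (nat -> nat) * (nat -> R[i])) :
    option ((nat -> nat) * (nat -> R[i])) :=
  let: (im, zm) := st in
  match i with
  | IConst d k => Some (upd im d k, zm)
  | IAdd d a b => Some (upd im d (im a + im b)%N, zm)
  | ISub d a b => Some (upd im d (im a - im b)%N, zm)
  | IMul d a b => Some (upd im d (im a * im b)%N, zm)
  | IDiv d a b => Some (upd im d (im a %/ im b)%N, zm)
  | ZConst d k => Some (im, upd zm (im d) k%:R)
  | ZMove d a => Some (im, upd zm (im d) (zm (im a)))
  | ZMul d a b => Some (im, upd zm (im d) (zm (im a) * zm (im b)))
  | _ => None
  end.

Fixpoint effects (b : seq instr) (st : (nat -> nat) * (nat -> R[i])) :=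
  if b is i :: b' then obind (effects b') (effect i st) else Some st.

Lemma triple_block b im zm im' zm' :
  effects b (im, zm) = Some (im', zm') ->
  triple (Block b) im zm (size b)%:R
    (fun im1 zm1 => im1 = im' /\ zm1 = zm').
Proof.
move=> E P p /= W; exists (size b)%:R, im', zm'; split=> //.
elim: b p im zm E W => [|i b IH] p im zm.
  by move=> [<- <-] _; rewrite addn0; apply: reaches_refl.
have -> : effects (i :: b) (im, zm) = obind (effects b) (effect i (im, zm)) by [].
case E: (effect i (im, zm)) => [[im1 zm1]|]//= /IH {}IH W.
rewrite addnS -addSn -natr1 addrC.
apply: (@reaches_step _ _ (State p.+1 im1 zm1)); last first.
  by apply: IH => j jb; rewrite addSnnS; apply: (W j.+1).
move: (W 0%N isT) E; rewrite addn0/= /step/fetch/= => ->.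
by case: i {W} => //= *; congr Some; congr pair; congruence.
Qed.

End Machine.

(** * Straight-line code and array-filling loops *)

Lemma effects_cons (R : realType) i b (st st1 : (nat -> nat) * (nat -> R[i])) r :
  effect i st = Some st1 -> effects b st1 = r -> effects (i :: b) st = r.
Proof.
have -> : effects (i :: b) st = obind (effects b) (effect i st) by [].
by move=> ->.
Qed.

Ltac read_reg im r :=
  lazymatch im with
  | upd ?f ?k ?v =>
      let b := eval vm_compute in (r == k)%N in
      lazymatch b with true => v | false => read_reg f r end
  | _ => constr:(im r)
  end.

(* Register values are looked up after every instruction: unfolding [effects]
   at once would give a term of exponential size. *)
Ltac run_block :=
  lazymatch goal with
  | |- effects (?i :: ?b) (?im, ?zm) = _ =>
      let next im' zm' :=
        (apply: (@effects_cons _ i b (im, zm) (im', zm')); first reflexivity) in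
      let arith d x y op :=
        (let u := read_reg im x in let v := read_reg im y in
         next (upd im d (op u v)) zm) in
      lazymatch i with
      | IConst ?d ?k => next (upd im d k) zm
      | IAdd ?d ?x ?y => arith d x y addn
      | ISub ?d ?x ?y => arith d x y subn
      | IMul ?d ?x ?y => arith d x y muln
      | IDiv ?d ?x ?y => arith d x y divn
      | ZConst ?d ?k => let a := read_reg im d in next im (upd zm a k%:R)
      | ZMove ?d ?x =>
          let a := read_reg im d in let u := read_reg im x in
          next im (upd zm a (zm u))
      | ZMul ?d ?x ?y =>
          let a := read_reg im d in
          let u := read_reg im x in let v := read_reg im y in
          next im (upd zm a (zm u * zm v))
      end; run_block
  | |- effects [::] _ = _ => reflexivity
  end.

(* Integer registers below 15 hold the parameters of the algorithm; 20, 21, 22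
   are the counter, bound and guard of the innermost loop, 23 is the guard of
   the main loop, and those from 30 on are scratch space of the loop bodies. *)
Definition same_params (im im' : nat -> nat) : Prop :=
  forall r, (r < 15)%N -> im' r = im r.

Lemma same_params_upd im im' d v :
  (15 <= d)%N -> same_params im im' -> same_params im (upd im' d v).
Proof. by move=> hd H r hr; rewrite /upd ltn_eqF ?H//; apply: leq_trans hd. Qed.

Lemma same_params_trans im1 im2 im3 :
  same_params im1 im2 -> same_params im2 im3 -> same_params im1 im3.
Proof. by move=> H1 H2 r hr; rewrite H2// H1. Qed.

(** The machine only tests for zero, so register 22 holds the bound minus the counter. *)
Definition fill (b : seq instr) : cmd :=
  Seq (Block [:: IConst 20 0; ISub 22 21 20])
      (While 22 (Block (b ++ [:: IAdd 20 20 2; ISub 22 21 20]))).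

Section Fill.
Variables (R : realType) (s : nat) (l : R).

Lemma effects_cat b1 b2 (st st' : (nat -> nat) * (nat -> R[i])) :
  effects b1 st = Some st' -> effects (b1 ++ b2) st = effects b2 st'.
Proof.
elim: b1 st => [|i b1 IH] st; first by case=> ->.
have E b : effects (i :: b) st = obind (effects b) (effect i st) by [].
by rewrite cat_cons !E; case: (effect i st) => //= st1; apply: IH.
Qed.

(* [good] singles out the cells whose final content matters: a body may also
   compute garbage from cells which the loop itself is overwriting. *)
Lemma triple_fill b im0 (zm0 : nat -> R[i]) N base (good : pred nat) v :
  im0 2%N = 1%N -> im0 21%N = N ->
  (forall im zm, same_params im0 im -> im 21%N = N -> (im 20%N < N)%N ->
     (forall a, ~~ (base <= a < base + N)%N -> zm a = zm0 a) ->
     (forall e, (e < im 20)%N -> good e -> zm (base + e)%N = v e) ->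
     exists im' a w,
       [/\ effects b (im, zm) = Some (im', upd zm a w), a = (base + im 20)%N,
           same_params im0 im', im' 21%N = N /\ im' 20%N = im 20%N
         & good (im 20%N) -> w = v (im 20%N)]) ->
  triple s l (fill b) im0 zm0 ((size b + 4) * N + 3)%:R (fun im' zm' =>
    [/\ same_params im0 im',
        forall a, ~~ (base <= a < base + N)%N -> zm' a = zm0 a
      & forall e, (e < N)%N -> good e -> zm' (base + e)%N = v e]).
Proof.
move=> one2 boundN H.
pose Q (e : nat) (im : nat -> nat) (zm : nat -> R[i]) :=
  [/\ same_params im0 im,
      forall a, ~~ (base <= a < base + N)%N -> zm a = zm0 a
    & forall i, (i < e)%N -> good i -> zm (base + i)%N = v i].
(* Induction on the number [k] of remaining iterations; each costs the body, two counter
   instructions, the test and the jump back. *)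
have loop k im zm : (k <= N)%N -> im 20%N = (N - k)%N -> im 21%N = N ->
    im 22%N = k -> Q (N - k)%N im zm ->
    triple s l (While 22 (Block (b ++ [:: IAdd 20 20 2; ISub 22 21 20]))) im zm
      ((size b + 4) * k + 1)%:R (Q N).
  elim: k im zm => [|k IH] im zm kN i20 i21 i22 [q1 q2 q3].
    by rewrite muln0; apply: triple_while_exit => //; rewrite subn0 in q3; split.
  have lt20 : (im 20 < N)%N by rewrite i20; lia.
  rewrite -i20 in q3.
  have [im' [a [w [E aE sp [i21' i20'] gw]]]] := H im zm q1 i21 lt20 q2 q3.
  have E2 : effects (b ++ [:: IAdd 20 20 2; ISub 22 21 20]) (im, zm) =
      Some (upd (upd im' 20 (N - k)%N) 22 k, upd zm a w).
    rewrite (effects_cat _ E) /= /upd /= (sp 2%N)// one2 i20' i21' i20.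
    by rewrite (_ : N - k.+1 + 1 = N - k)%N ?subKn//; lia.
  have -> : ((size b + 4) * k.+1 + 1)%:R =
      (size (b ++ [:: IAdd 20 20 2; ISub 22 21 20]))%:R +
      ((size b + 4) * k + 1)%:R + 2 :> R.
    by rewrite size_cat/= -!natrD; congr _%:R; lia.
  apply: triple_while_next; first by rewrite i22.
  apply: triple_weaken (triple_block _ _ E2) (lexx _) _ => _ _ [-> ->].
  apply: IH => //; first exact: ltnW.
  split.
  - by do 2!apply: same_params_upd => //.
  - by move=> x hx; rewrite /upd aE i20; case: eqP => [xE|_]; [lia | exact: q2].
  - move=> i iN gi; rewrite /upd aE i20 eqn_add2l; case: eqP => [ie|ne].
      by rewrite ie -i20 gw// i20 -ie.
    by apply: q3 => //; lia.
rewrite (_ : _%:R = (size [:: IConst 20 0; ISub 22 21 20])%:R +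
  ((size b + 4) * N + 1)%:R); last by rewrite -natrD/=; congr _%:R; lia.
apply: triple_seq.
apply: triple_weaken (triple_block _ _ _) (lexx _) _.
  by run_block.
move=> _ _ [-> ->]; apply: loop => //.
- by rewrite /upd/= subnn.
- by rewrite /upd/= boundN subn0.
- by rewrite subnn; split=> //; do 2!apply: same_params_upd => //.
Qed.

End Fill.

(** * Partial Fourier transforms *)

Lemma ltn_mulD q f p m : (q < f)%N -> (p < m)%N -> (q * m + p < f * m)%N.
Proof.
move=> qf pm; apply: (@leq_trans (q.+1 * m)); last by rewrite leq_mul2r qf orbT.
by rewrite mulSnr ltn_add2l.
Qed.

Section PartialDft.
Variable K : comNzRingType.

Lemma big_ord_divmod (L f : nat) (F : nat -> K) :
  \sum_(j < L * f) F j = \sum_(q < f) \sum_(j < L) F (j * f + q)%N.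
Proof.
rewrite exchange_big/= -(big_mkord xpredT F).
elim: L => [|L IH]; first by rewrite mul0n big_geq// big_ord0.
rewrite mulSnr (big_cat_nat (n := (L * f)%N))//= ?leq_addr// IH big_ord_recr/=.
congr (_ + _).
rewrite -{1}[(L * f)%N]add0n big_addn addKn big_mkord.
by apply: eq_bigr => i _; rewrite addnC.
Qed.

Lemma big_ord_window (s a f : nat) (F : nat -> K) :
  (a + f <= s)%N -> (forall b, ~~ (a <= b < a + f)%N -> F b = 0) ->
  \sum_(b < s) F b = \sum_(q < f) F (a + q)%N.
Proof.
move=> afs F0; rewrite -(big_mkord xpredT F).
have a_s : (a <= s)%N by apply: leq_trans afs; apply: leq_addr.
rewrite (big_cat_nat (n := a))//=.
rewrite [X in X + _]big_nat_cond big1 ?add0r; last first.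
  by move=> b ba; rewrite F0//; lia.
rewrite (big_cat_nat (n := (a + f)%N))//= ?leq_addr//.
rewrite [X in _ + X]big_nat_cond [X in _ + X]big1 ?addr0; last first.
  by move=> b ba; rewrite F0//; lia.
rewrite -{1}[a]add0n big_addn addKn big_mkord.
by apply: eq_bigr => i _; rewrite addnC.
Qed.

Variables (w : K) (n : nat).
Hypothesis wn : w ^+ n = 1.

Lemma exp_unity_mod e : w ^+ (e %% n) = w ^+ e.
Proof. by rewrite {2}(divn_eq e n) exprD mulnC exprM wn expr1n mul1r. Qed.

Lemma exp_unity_add_mul e q : w ^+ (n * q + e) = w ^+ e.
Proof. by rewrite exprD exprM wn expr1n mul1r. Qed.

(* The entry [k * M + p] is the [k]-th entry of the DFT of the [n / M] inputs
   whose index is [p] modulo [M]: this is the input for [M = n] and its DFT for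
   [M = 1]. *)
Definition partial_dft (x : nat -> K) (M o : nat) : K :=
  \sum_(j < n %/ M) x (j * M + o %% M)%N * w ^+ (M * j * (o %/ M)).

(** With [n = L * f * M], the exponent [M * (j * f + q) * (u * L + k)] expands into [f * M * j * k]
    for the shorter transform, the twiddle [k * q * M], the Fourier entry [(n / f) * q * u], and
    [n * j * u], which vanishes because [w ^+ n = 1]. *)
Lemma partial_dft_step x f M o :
  (0 < f)%N -> (0 < M)%N -> (f * M %| n)%N -> (o < n)%N ->
  let i := (o %% (n %/ f))%N in let u := (o %/ (n %/ f))%N in
  let k := (i %/ M)%N in
  partial_dft x M o =
  \sum_(q < f) partial_dft x (f * M) (k * (f * M) + q * M + i %% M) *
               w ^+ (k * q * M) * w ^+ ((n %/ f) * q * u).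
Proof.
move=> f0 M0 /dvdnP[L nE] on i u k.
have nf : (n %/ f = L * M)%N by rewrite nE mulnCA mulKn.
have nM : (n %/ M = L * f)%N by rewrite nE mulnA mulnK.
have nfM : (n %/ (f * M) = L)%N by rewrite nE mulnK// muln_gt0 f0.
have oE : o = (u * (L * M) + i)%N by rewrite /u /i nf -divn_eq.
have oM : (o %% M = i %% M)%N by rewrite oE mulnA modnMDl.
have odM : (o %/ M = u * L + k)%N by rewrite oE mulnA divnMDl.
rewrite /partial_dft nM oM odM nfM (big_ord_divmod _ _ (fun j =>
  x (j * M + i %% M)%N * w ^+ (M * j * (u * L + k)))).
apply: eq_bigr => q _; rewrite !mulr_suml; apply: eq_bigr => j _.
have pM : (q * M + i %% M < f * M)%N.
  by rewrite ltn_mulD// ltn_pmod.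
rewrite -addnA modnMDl (modn_small pM) divnMDl ?muln_gt0 ?f0// (divn_small pM).
rewrite addn0 nf -!mulrA -!exprD; congr (x _ * _); first by rewrite mulnDl -mulnA addnA.
rewrite -[RHS](exp_unity_add_mul _ (j * u)); congr (w ^+ _); rewrite nE; ring.
Qed.

(** The exponent may use full indices instead of residues modulo [f]: [w ^+ (n %/ f)] is an [f]-th
    root of unity, so the block offset [c0 * f] drops out and each full block acts as the Fourier
    matrix of order [f]. *)
Lemma sum_block_diagonal (s f c0 u : nat) (g : nat -> K) :
  (u < f)%N -> (c0 * f + f <= s)%N -> (f %| n)%N ->
  let col := (c0 * f + u)%N in
  \sum_(b < s) g b *
    (if (b %/ f == col %/ f)%N then w ^+ ((n %/ f) * b * col) else 0) =
  \sum_(q < f) g (c0 * f + q)%N * w ^+ ((n %/ f) * q * u).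
Proof.
move=> uf le /dvdnP[m nE] col; have f0 : (0 < f)%N by apply: leq_ltn_trans uf.
have colf : (col %/ f = c0)%N by rewrite divnMDl// divn_small// addn0.
rewrite (big_ord_window (a := c0 * f) (f := f) (F := fun b => g b *
    (if (b %/ f == col %/ f)%N then w ^+ ((n %/ f) * b * col) else 0)))//.
  apply: eq_bigr => q _; rewrite colf divnMDl// divn_small// addn0 eqxx.
  congr (_ * _).
  rewrite -[RHS](exp_unity_add_mul _ (c0 * (c0 * f + q + u))); congr (w ^+ _).
  by rewrite nE mulnK// /col; ring.
move=> b bP; case: eqP => [bE|_]; last by rewrite mulr0.
case/negP: bP; rewrite colf in bE.
by rewrite -bE leq_divM -mulSnr ltn_ceil.
Qed.

End PartialDft.

(** * Complex roots of unity *)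

Section Cexp.
Variable R : realType.

Lemma cexpD (z1 z2 : R[i]) : cexp (z1 + z2) = cexp z1 * cexp z2.
Proof.
case: z1 z2 => a1 b1 [a2 b2].
rewrite /cexp /= expRD cosD sinD.
apply/eqP; rewrite eq_complex /=; apply/andP; split; apply/eqP; ring.
Qed.

Lemma cexp0 : cexp (0 : R[i]) = 1.
Proof. by rewrite /cexp/= expR0 cos0 sin0 mulr1 mulr0. Qed.

Lemma cexpMn (z : R[i]) k : cexp (z * k%:R) = cexp z ^+ k.
Proof.
elim: k => [|k IH]; first by rewrite mulr0 cexp0.
by rewrite -natr1 mulrDr mulr1 cexpD IH exprSr.
Qed.

Lemma cexp_unity_root n : (0 < n)%N ->
  cexp (- (2 * (pi : R)%:C%C * 'i%C / n%:R)) ^+ n = 1.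
Proof.
move=> n0; rewrite -cexpMn mulNr divfK; last by rewrite pnatr_eq0 -lt0n.
have -> : - (2 * (pi : R)%:C%C * 'i%C) = (0 +i* (- (pi *+ 2)))%C.
  apply/eqP; rewrite eq_complex/=; apply/andP; split; apply/eqP; rewrite ?mulr2n; ring.
by rewrite /cexp expR0 cosN sinN cos2pi sin2pi oppr0 !mul1r.
Qed.

End Cexp.

(** * The program *)

Local Notation rN := 0%N (only parsing).
Local Notation rS := 1%N (only parsing).
Local Notation rOne := 2%N (only parsing).
Local Notation rNull := 3%N (only parsing).
Local Notation rM := 4%N (only parsing).
Local Notation rTable := 5%N (only parsing).
Local Notation rMatrix := 6%N (only parsing).
Local Notation rLeft := 7%N (only parsing).
Local Notation rProd := 8%N (only parsing).
Local Notation rZero := 9%N (only parsing).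
Local Notation rRadix := 10%N (only parsing).
Local Notation rQuot := 11%N (only parsing).
Local Notation rPack := 12%N (only parsing).
Local Notation rCount := 13%N (only parsing).
Local Notation rHeight := 14%N (only parsing).
Local Notation rIdx := 20%N (only parsing).
Local Notation rBound := 21%N (only parsing).
Local Notation rMore := 23%N (only parsing).

(** Memory layout: data from cell 0, the root of unity in n, a zero in n + 1, its powers from n + 2,
    the s by s matrix (at most n cells) from 2n + 3, the left operand (at most 4n cells) from 3n +
    3, the product from 7n + 3. *)
Definition setup : seq instr :=
  [:: IConst rOne 1; IAdd rNull rN rOne; IAdd rTable rNull rOne;
      ZConst rTable 1; IAdd rMatrix rTable rOne; IAdd rMatrix rMatrix rN;
      IAdd rLeft rMatrix rN; IAdd rProd rLeft rN; IAdd rProd rProd rN;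
      IAdd rProd rProd rN; IAdd rProd rProd rN; IConst rZero 0;
      IAdd rM rN rZero; IAdd rBound rN rZero].

(** [rN] also acts as an address, since the input keeps the root of unity in cell [n]. *)
Definition table_body : seq instr :=
  [:: IAdd 30 rTable rIdx; IAdd 31 30 rOne; ZMul 31 30 rN].

(** By truncation, [M - (M - s)] is the minimum of [M] and [s]. The height is a rounded-down
    quotient plus one, leaving room for an incomplete last row. *)
Definition stage_setup : seq instr :=
  [:: ISub rRadix rM rS; ISub rRadix rM rRadix; IDiv rQuot rM rRadix;
      IDiv rPack rS rRadix; IDiv rCount rN rRadix; IDiv rHeight rCount rPack;
      IAdd rHeight rHeight rOne; IMul rBound rS rS].

(* The cell [rNull] holds 0 and is followed by the table of powers, so that the
   0/1 flag in register 34 selects a power or 0 without a branch. *)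
Definition matrix_body : seq instr :=
  [:: IDiv 30 rIdx rS; IMul 31 30 rS; ISub 31 rIdx 31;
      IDiv 32 30 rRadix; IDiv 33 31 rRadix; ISub 34 32 33; ISub 35 33 32;
      IAdd 34 34 35; ISub 34 rOne 34;
      IMul 35 rCount 30; IMul 35 35 31; IDiv 36 35 rN; IMul 36 36 rN;
      ISub 35 35 36; IAdd 35 35 rOne; IMul 35 34 35; IAdd 35 rNull 35;
      IAdd 36 rMatrix rIdx; ZMove 36 35].

(** Registers 34 and 33 hold the row [i] and column [q] of the entry in the unpacked [n / f] by [f]
    matrix; 37 is its source address, 38 the address of its twiddle factor. *)
Definition gather_body : seq instr :=
  [:: IDiv 30 rIdx rS; IMul 31 30 rS; ISub 31 rIdx 31;
      IDiv 32 31 rRadix; IMul 33 32 rRadix; ISub 33 31 33;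
      IMul 34 30 rPack; IAdd 34 34 32;
      IDiv 35 34 rQuot; IMul 36 35 rQuot; ISub 36 34 36;
      IMul 37 35 rM; IMul 38 33 rQuot; IAdd 37 37 38; IAdd 37 37 36;
      IMul 38 35 33; IMul 38 38 rQuot; IAdd 38 rTable 38;
      IAdd 39 rLeft rIdx; ZMul 39 37 38].

(** Cell [u * (n / f) + i] receives entry [(i, u)] of the unpacked product, which is the
    transposition. As the data begin at address 0, [rIdx] is itself the destination. *)
Definition scatter_body : seq instr :=
  [:: IDiv 30 rIdx rCount; IMul 31 30 rCount; ISub 31 rIdx 31;
      IDiv 32 31 rPack; IMul 33 32 rPack; ISub 33 31 33;
      IMul 32 32 rS; IMul 33 33 rRadix; IAdd 32 32 33; IAdd 32 32 30;
      IAdd 32 rProd 32; ZMove rIdx 32].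

Definition stage : cmd :=
  Seq (Block stage_setup) (Seq (fill matrix_body)
  (Seq (Block [:: IMul rBound rHeight rS]) (Seq (fill gather_body)
  (Seq (Call rProd rLeft rMatrix rHeight)
  (Seq (Block [:: IAdd rBound rN rZero]) (Seq (fill scatter_body)
       (Block [:: IAdd rM rQuot rZero; ISub rMore rM rOne]))))))).

Definition fft : cmd :=
  Seq (Block setup) (Seq (fill table_body)
  (Seq (Block [:: ISub rMore rM rOne]) (While rMore stage))).

Definition loop_regs (n s M : nat) : seq nat :=
  [:: n; s; 1%N; n.+1; M; n.+2; (2 * n + 3)%N; (3 * n + 3)%N; (7 * n + 3)%N; 0%N].

Definition stage_regs (n s M f : nat) : seq nat :=
  loop_regs n s M ++
  [:: f; M %/ f; s %/ f; n %/ f; (n %/ f %/ (s %/ f)).+1]%N.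

(** The loop bodies compute remainders in this form, for want of a remainder instruction. *)
Lemma sub_divM_mod a b : (a - a %/ b * b)%N = (a %% b)%N.
Proof. by rewrite {1}(divn_eq a b) addKn. Qed.

Lemma sub1_dist a b : a != b -> (1 - ((a - b) + (b - a)) = 0)%N.
Proof. by lia. Qed.

Lemma write_mxE (T : Type) p q (z : nat -> T) a (A : 'M[T]_(p, q))
    (i : 'I_p) (j : 'I_q) :
  write_mx z a A (a + (i * q + j))%N = A i j.
Proof.
have q0 : (0 < q)%N by apply: leq_ltn_trans (ltn_ord j).
rewrite /write_mx leq_addr addKn divnMDl// divn_small// addn0 modnMDl modn_small//.
by rewrite !valK.
Qed.

Lemma write_mx_below (T : Type) p q (z : nat -> T) a (A : 'M[T]_(p, q)) k :
  (k < a)%N -> write_mx z a A k = z k.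
Proof. by move=> ka; rewrite /write_mx leqNgt ka. Qed.

(** * Correctness and cost of one stage *)

Section Stage.
Variables (R : realType) (s n M f : nat) (l : R) (w : R[i]) (x : nat -> R[i]).
Hypotheses (wn : w ^+ n = 1) (ssn : (s * s <= n)%N) (f0 : (0 < f)%N)
  (fs : (f <= s)%N) (fM : (f %| M)%N) (Mn : (M %| n)%N) (M0 : (0 < M)%N).

Definition power_table (zm : nat -> R[i]) : Prop :=
  zm n.+1 = 0 /\ forall e, (e < n)%N -> zm (n.+2 + e)%N = w ^+ e.

Let n0 : (0 < n)%N. Proof. by move: f0 fs ssn; nia. Qed.
Let fn : (f %| n)%N. Proof. exact: dvdn_trans fM Mn. Qed.
Let c0 : (0 < s %/ f)%N. Proof. by rewrite divn_gt0. Qed.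

(** A mixed-radix expansion: the leading digit is below [n / M], the next is [q < f], the last is
    below [M / f]. *)
Lemma source_lt i q : (i < n %/ f)%N -> (q < f)%N ->
  (i %/ (M %/ f) * M + q * (M %/ f) + i %% (M %/ f) < n)%N.
Proof.
have M'0 : (0 < M %/ f)%N by rewrite divn_gt0// dvdn_leq.
have [L nE] := dvdnP Mn; rewrite {1}nE -muln_divA// => iL qf.
rewrite -addnA [ltnRHS]nE ltn_mulD//; first by rewrite ltn_divLR.
by rewrite -[ltnRHS](divnK fM) [ltnRHS]mulnC ltn_mulD// ltn_pmod.
Qed.

Lemma triple_matrix im zm :
  same_params (nth 0%N (stage_regs n s M f)) im -> im 21%N = (s * s)%N ->
  power_table zm ->
  triple s l (fill matrix_body) im zm (23 * (s * s) + 3)%:R (fun im' zm' =>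
    [/\ same_params im im',
        forall a, ~~ (2 * n + 3 <= a < 2 * n + 3 + s * s)%N -> zm' a = zm a
      & forall a b, (a < s)%N -> (b < s)%N ->
          zm' (2 * n + 3 + (a * s + b))%N =
          if (a %/ f == b %/ f)%N then w ^+ ((n %/ f) * a * b) else 0]).
Proof.
move=> regs bound [null tab].
pose v e : R[i] := if ((e %/ s) %/ f == (e %% s) %/ f)%N
  then w ^+ ((n %/ f) * (e %/ s) * (e %% s)) else 0.
apply: triple_weaken (triple_fill s l (b := matrix_body) (base := 2 * n + 3)
  (good := xpredT) (v := v) _ bound _) (lexx _) _.
- by rewrite (regs 2%N).
- move=> im1 zm1 sp1 b1 lt1 out _; have regs1 := same_params_trans regs sp1.
  eexists; eexists; eexists; split.
  + by rewrite /matrix_body; run_block.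
  + by rewrite (regs1 6%N).
  + by do !apply: same_params_upd => //.
  + by [].
  + move=> _; rewrite (regs1 0%N)// (regs1 1%N)// (regs1 2%N)// (regs1 3%N)//.
    rewrite (regs1 10%N)// (regs1 13%N)//= !sub_divM_mod /v.
    (* Equal block indices give flag 1 and a power whose exponent was reduced modulo [n] to stay
       inside the table; otherwise flag 0 selects the zero in cell [n + 1]. *)
    case: eqP => [->|/eqP ne].
      rewrite subnn addn0 subn0 mul1n.
      have lt := ltn_pmod (n %/ f * (im1 20%N %/ s) * (im1 20%N %% s)) n0.
      rewrite out; last by move: lt; set y := (_ %% n)%N; lia.
      by rewrite addn1 -addSnnS tab// exp_unity_mod.
    by rewrite sub1_dist// mul0n addn0 out//; lia.
- move=> im' zm' [sp out val]; split=> // a b sa sb.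
  have s0 : (0 < s)%N by apply: leq_ltn_trans sa.
  rewrite val//.
    by rewrite /v divnMDl// (divn_small sb) addn0 modnMDl (modn_small sb).
  by move: sa sb; nia.
Qed.

Lemma triple_gather im zm :
  same_params (nth 0%N (stage_regs n s M f)) im ->
  im 21%N = ((n %/ f %/ (s %/ f)).+1 * s)%N -> power_table zm ->
  triple s l (fill gather_body) im zm
    (24 * ((n %/ f %/ (s %/ f)).+1 * s) + 3)%:R (fun im' zm' =>
    [/\ same_params im im',
        forall a, (a < 3 * n + 3)%N -> zm' a = zm a
      & forall i q, (i < n %/ f)%N -> (q < f)%N ->
          zm' (3 * n + 3 + (i %/ (s %/ f) * s + (i %% (s %/ f) * f + q)))%N =
          zm (i %/ (M %/ f) * M + q * (M %/ f) + i %% (M %/ f))%N *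
          w ^+ (i %/ (M %/ f) * q * (M %/ f))]).
Proof.
move=> regs bound [null tab].
pose c := (s %/ f)%N; pose M' := (M %/ f)%N.
pose ei e := (e %/ s * c + (e %% s) %/ f)%N.
pose qi e := ((e %% s) %% f)%N.
(* The garbage cells are the columns left over when [f] does not divide [s]
   and the end of the last row. *)
pose v e : R[i] := zm (ei e %/ M' * M + qi e * M' + ei e %% M')%N *
  w ^+ (ei e %/ M' * qi e * M').
apply: triple_weaken (triple_fill s l (b := gather_body) (base := 3 * n + 3)
  (good := fun e => (ei e < n %/ f)%N) (v := v) _ bound _) (lexx _) _.
- by rewrite (regs 2%N).
- move=> im1 zm1 sp1 b1 lt1 out _; have regs1 := same_params_trans regs sp1.
  eexists; eexists; eexists; split.
  + by rewrite /gather_body; run_block.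
  + by rewrite (regs1 7%N).
  + by do !apply: same_params_upd => //.
  + by [].
  + rewrite (regs1 1%N)// (regs1 4%N)// (regs1 5%N)//.
    rewrite (regs1 10%N)// (regs1 11%N)// (regs1 12%N)//= !sub_divM_mod.
    rewrite -/M' -/c -/(ei _) -/(qi _); set e := im1 _ => ie.
    have qf : (qi e < f)%N by rewrite ltn_pmod.
    have M'0 : (0 < M')%N by rewrite divn_gt0// dvdn_leq.
    have src_n : (ei e %/ M' * M + qi e * M' + ei e %% M' < n)%N by apply: source_lt.
    (* Since [qi e * M' <= M], the twiddle exponent is at most the leading term of the source index,
       so it is in the table without reduction modulo [n]. *)
    have tw_n : (ei e %/ M' * qi e * M' < n)%N.
      apply: leq_ltn_trans src_n; rewrite -mulnA -addnA; apply: leq_trans (leq_addr _ _).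
      by rewrite leq_mul2l -[leqRHS](divnK fM) -/M' mulnC leq_mul2l (ltnW qf) !orbT.
    have below a : (a < 3 * n + 3)%N -> zm1 a = zm a by move=> an; apply: out; lia.
    rewrite !below ?tab//.
      by apply: (@leq_trans (n.+2 + n)); [rewrite ltn_add2l | lia].
    by apply: ltn_trans src_n _; lia.
- move=> im' zm' [sp out val]; split=> // [a an|i q iN qf].
    by apply: out; lia.
  have s0 : (0 < s)%N by apply: leq_trans fs.
  have cs : (i %% c * f + q < s)%N.
    have := ltn_pmod i c0; rewrite -/c => ic.
    by apply: leq_trans (leq_divM s f); rewrite ltn_mulD.
  have ediv : ((i %/ c * s + (i %% c * f + q)) %/ s = i %/ c)%N.
    by rewrite divnMDl// (divn_small cs) addn0.
  have emod : ((i %/ c * s + (i %% c * f + q)) %% s = i %% c * f + q)%N.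
    by rewrite modnMDl (modn_small cs).
  have eiE : ei (i %/ c * s + (i %% c * f + q))%N = i.
    by rewrite /ei ediv emod divnMDl// (divn_small qf) addn0 -divn_eq.
  have qiE : qi (i %/ c * s + (i %% c * f + q))%N = q.
    by rewrite /qi emod modnMDl (modn_small qf).
  rewrite val; first by rewrite /v eiE qiE.
    apply: (@leq_trans ((i %/ c).+1 * s)); first by rewrite mulSnr ltn_add2l.
    by rewrite leq_mul2r ltnS leq_div2r ?orbT// ltnW.
  by rewrite eiE.
Qed.

Lemma triple_scatter im zm :
  same_params (nth 0%N (stage_regs n s M f)) im -> im 21%N = n ->
  triple s l (fill scatter_body) im zm (16 * n + 3)%:R (fun im' zm' =>
    [/\ same_params im im', forall a, (n <= a)%N -> zm' a = zm a
      & forall o, (o < n)%N ->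
          let i := (o %% (n %/ f))%N in let u := (o %/ (n %/ f))%N in
          zm' o = zm (7 * n + 3 + (i %/ (s %/ f) * s +
                                  (i %% (s %/ f) * f + u)))%N]).
Proof.
move=> regs bound.
pose v o : R[i] :=
  let i := (o %% (n %/ f))%N in let u := (o %/ (n %/ f))%N in
  zm (7 * n + 3 + (i %/ (s %/ f) * s + (i %% (s %/ f) * f + u)))%N.
apply: triple_weaken (triple_fill s l (b := scatter_body) (base := 0)
  (good := xpredT) (v := v) _ bound _) (lexx _) _.
- by rewrite (regs 2%N).
- move=> im1 zm1 sp1 b1 lt1 out _; have regs1 := same_params_trans regs sp1.
  eexists; eexists; eexists; split.
  + by rewrite /scatter_body; run_block.
  + by [].
  + by do !apply: same_params_upd => //.
  + by [].
  + move=> _; rewrite (regs1 1%N)// (regs1 8%N)//.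
    rewrite (regs1 10%N)// (regs1 12%N)// (regs1 13%N)//= !sub_divM_mod.
    have above a : (n <= a)%N -> zm1 a = zm a by move=> na; apply: out; lia.
    rewrite above /v; first by rewrite !addnA.
    by apply: leq_trans (leq_addr _ _); lia.
- move=> im' zm' [sp out val]; split=> // [a na|o on]; first by apply: out; lia.
  exact: val o on isT.
Qed.

(** The tensor unit demands [s] rows: a row absorbs at most [s] of the [n >= s * s] entries. *)
Lemma height_ge : (s <= (n %/ f %/ (s %/ f)).+1)%N.
Proof.
rewrite -divnMA; apply: leqW; rewrite leq_divRL ?muln_gt0 ?f0//.
by apply: leq_trans ssn; rewrite leq_mul2l mulnC leq_divM orbT.
Qed.

(** Packing uses [d = f * (s / f)] columns, at least half of each row, so the total is at most
    [2 * n + 2 * d], and [d <= s <= n]. *)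
Lemma height_le : ((n %/ f %/ (s %/ f)).+1 * s <= 4 * n)%N.
Proof.
rewrite -divnMA; set d := (f * (s %/ f))%N.
have sd : (s <= 2 * d)%N.
  have := ltn_ceil s f0; rewrite mulSnr mulnC -/d => /ltnW h.
  by apply: leq_trans h _; rewrite mul2n -addnn leq_add2l /d leq_pmulr.
have ds : (d <= s)%N by rewrite /d mulnC leq_divM.
have sn : (s <= n)%N by apply: leq_trans ssn; rewrite leq_pmulr// (leq_trans f0).
have := leq_divM n d; move: sd ds sn; set h := (n %/ d)%N; clearbody d h.
move=> sd ds sn hd; apply: (@leq_trans (h.+1 * (2 * d))).
  by rewrite leq_mul2l sd orbT.
by rewrite mulnCA mulSn; lia.
Qed.

Lemma triple_stage im zm :
  f = (M - (M - s))%N ->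
  (forall r, (r < 10)%N -> im r = nth 0%N (loop_regs n s M) r) ->
  power_table zm -> (forall o, (o < n)%N -> zm o = partial_dft w n x M o) ->
  triple s l stage im zm ((160 * n)%:R + l) (fun im' zm' =>
    [/\ forall r, (r < 10)%N -> im' r = nth 0%N (loop_regs n s (M %/ f)) r,
        im' 23%N = (M %/ f - 1)%N, power_table zm'
      & forall o, (o < n)%N -> zm' o = partial_dft w n x (M %/ f) o]).
Proof.
move=> fE regs tab zmE; set h := (n %/ f %/ (s %/ f)).+1.
(* The summands are the costs of the eight commands of [stage], in order. *)
apply: (@triple_weaken _ _ _ _ _ _ (8 + ((23 * (s * s) + 3)%:R + (1 +
  ((24 * (h * s) + 3)%:R + (((h * s)%:R + l) + (1 + ((16 * n + 3)%:R + 2))))))));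
  last by move=> ? ?; apply.
- apply: triple_seq; apply: triple_weaken (triple_block _ _ _) (lexx _) _.
    by rewrite /stage_setup; run_block.
  move=> im1 _ [im1E ->].
  have regs1 : same_params (nth 0%N (stage_regs n s M f)) im1.
    rewrite im1E (regs 0%N)// (regs 1%N)// (regs 2%N)// (regs 4%N)//= -fE addn1.
    by do 15![case=> [|]; first by rewrite /upd/= ?regs].
  have b1 : im1 21%N = (s * s)%N by rewrite im1E /upd/= (regs 1%N).
  clear im1E.
  apply: triple_seq.
  apply: triple_weaken (triple_matrix regs1 b1 tab) (lexx _) _.
  move=> im2 zm2 [/(same_params_trans regs1) regs2 out2 val2].
  have low2 a : (a < 2 * n + 3)%N -> zm2 a = zm a by move=> ?; apply: out2; lia.
  have tab2 : power_table zm2.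
    case: tab => t0 t1; split=> [|e en]; rewrite low2 ?t0 ?t1//; lia.
  apply: triple_seq; apply: triple_weaken (triple_block _ _ _) (lexx _) _.
    by run_block.
  move=> im3 _ [im3E ->].
  have regs3 : same_params (nth 0%N (stage_regs n s M f)) im3.
    by rewrite im3E; apply: same_params_upd.
  have b3 : im3 21%N = (h * s)%N.
    by rewrite im3E /upd/= (regs2 14%N)// (regs2 1%N).
  clear im3E.
  apply: triple_seq.
  apply: triple_weaken (triple_gather regs3 b3 tab2) (lexx _) _.
  move=> im4 zm4 [/(same_params_trans regs3) regs4 low4 val4].
  have h4 : im4 14%N = h by rewrite (regs4 14%N).
  apply: triple_seq.
  have sh4 : (s <= im4 14)%N by rewrite h4 height_ge.
  apply: (triple_weaken (triple_call l zm4 sh4)); first by rewrite h4.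
  move=> _ zm5 [-> zm5E].
  rewrite (regs4 6%N)// (regs4 7%N)// (regs4 8%N)// h4/= in zm5E.
  apply: triple_seq; apply: triple_weaken (triple_block _ _ _) (lexx _) _.
    by run_block.
  move=> im6 _ [im6E ->].
  have regs6 : same_params (nth 0%N (stage_regs n s M f)) im6.
    by rewrite im6E; apply: same_params_upd.
  have b6 : im6 21%N = n.
    by rewrite im6E /upd/= (regs4 0%N)// (regs4 9%N)//= addn0.
  clear im6E.
  apply: triple_seq.
  apply: triple_weaken (triple_scatter zm5 regs6 b6) (lexx _) _.
  move=> im7 zm7 [/(same_params_trans regs6) regs7 high7 val7].
  apply: triple_weaken (triple_block _ _ _) (lexx _) _.
    by run_block.
  move=> im8 _ [im8E ->]; split.
  + rewrite im8E (regs7 11%N)// (regs7 9%N)//= addn0.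
    by do 10![case=> [|]; first by rewrite /upd/= ?regs7].
  + by rewrite im8E /upd/= (regs7 11%N)// (regs7 9%N)// (regs7 2%N)//= addn0.
  + case: tab2 => t0 t1; split=> [|e en];
      by rewrite high7 ?zm5E ?write_mx_below ?low4 ?t0 ?t1//; lia.
  + move=> o on; rewrite val7//.
    have M'0 : (0 < M %/ f)%N by rewrite divn_gt0// dvdn_leq.
    have fM' : (f * (M %/ f) = M)%N by rewrite mulnC divnK.
    have nf0 : (0 < n %/ f)%N by rewrite divn_gt0// dvdn_leq.
    rewrite (@partial_dft_step _ w n wn x f)// ?fM'//.
    set i := (o %% (n %/ f))%N; set u := (o %/ (n %/ f))%N.
    have inf : (i < n %/ f)%N by rewrite ltn_pmod.
    have uf : (u < f)%N by rewrite /u ltn_divLR// mulnC divnK.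
    have ic : (i %% (s %/ f) < s %/ f)%N by rewrite ltn_pmod.
    have blk : (i %% (s %/ f) * f + f <= s)%N.
      by apply: leq_trans (leq_divM s f); rewrite -mulSnr leq_mul2r ic orbT.
    have row_h : (i %/ (s %/ f) < h)%N by rewrite ltnS leq_div2r// ltnW.
    have col_s : (i %% (s %/ f) * f + u < s)%N.
      by apply: leq_trans blk; rewrite ltn_add2l.
    rewrite zm5E -[X in (X * s)%N]/(val (Ordinal row_h))
      -[X in (_ * s + X)%N]/(val (Ordinal col_s)) write_mxE mxE.
    transitivity (\sum_(b < s)
        zm4 (3 * n + 3 + (i %/ (s %/ f) * s + b))%N *
        (if (b %/ f == (i %% (s %/ f) * f + u) %/ f)%N
         then w ^+ (n %/ f * b * (i %% (s %/ f) * f + u)) else 0)).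
      apply: eq_bigr => b _; rewrite !mxE/=.
      congr (zm4 _ * _); first by rewrite addnA.
      (* The matrix ends before cell 3n + 3 because [s * s <= n], so gathering has left it
         intact. *)
      rewrite -[X in zm4 X]addnA low4; first by apply: val2.
      have : (b * s + (i %% (s %/ f) * f + u) < s * s)%N by rewrite ltn_mulD.
      by move: ssn; set y := (b * s + _)%N; clearbody y; clear; lia.
    rewrite (sum_block_diagonal wn
      (fun b => zm4 (3 * n + 3 + (i %/ (s %/ f) * s + b))%N) uf blk fn).
    apply: eq_bigr => q _; have src := source_lt inf (ltn_ord q).
    rewrite val4// low2 ?zmE//.
    by apply: ltn_trans src _; lia.
(* With [s * s <= n], [h * s <= 4 * n] and [1 <= n], the constant is 21 + 23 + 100 + 16 = 160. *)
- have := height_le; rewrite -/h => hs.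
  rewrite [leLHS](_ : _ = (21 + 23 * (s * s) + 25 * (h * s) + 16 * n)%:R + l).
    rewrite lerD2r ler_nat; move: n0 ssn hs.
    by set a := (s * s)%N; set b := (h * s)%N; clearbody a b; clear; lia.
  by ring.
Qed.

End Stage.

(** Each of the [D] stages has a surplus [30 * N + 189 * l - 2]; a single one pays for the setup and
    the power table. The final -1 is reserved for [Halt]. *)
Lemma fft_cost_le (R : realFieldType) (D N l : R) : 1 <= D -> 4 <= N -> 0 <= l ->
  14 + (7 * N + 3 + (1 + (D * (160 * N + l + 2) + 1))) <= D * (190 * (N + l)) - 1.
Proof.
move=> D1 N4 l0; have D0 : 0 <= D - 1 by lra.
have N0 : 0 <= 30 * N + 189 * l - 2 by lra.
by have := mulr_ge0 D0 N0; lra.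
Qed.

(** * The complete transform *)

Section Fft.
Variables (R : realType) (s n : nat) (l : R) (w : R[i]).
Hypotheses (wn : w ^+ n = 1) (s1 : (1 < s)%N) (ssn : (s * s <= n)%N) (l0 : 0 <= l).

(** [d] counts the stages of radix [s]; at most one further stage, of radix [M <= s], finishes. The
    bound on [s ^ d] later turns into a logarithm. *)
Lemma triple_stages x M : splittable s M -> exists2 d, (s ^ d <= M)%N &
  (M %| n)%N -> forall im zm,
  (forall r, (r < 10)%N -> im r = nth 0%N (loop_regs n s M) r) ->
  im 23%N = (M - 1)%N -> power_table n w zm ->
  (forall o, (o < n)%N -> zm o = partial_dft w n x M o) ->
  triple s l (While 23 stage) im zm (d.+1%:R * ((160 * n)%:R + l + 2) + 1)
    (fun _ zm' => forall o, (o < n)%N -> zm' o = partial_dft w n x 1 o).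
Proof.
have B0 : 0 <= (160 * n)%:R + l + 2 by rewrite !addr_ge0.
elim=> {M} [M /andP[M0 Ms]|M sM sdM _ [d dM IH]].
  exists 0%N; first by rewrite expn0.
  move=> Mn im zm regs i23 tab zmE; rewrite mul1r.
  have [M1|M1] := leqP M 1.
    have ME : M = 1%N by lia.
    rewrite ME in i23 zmE.
    apply: triple_weaken (triple_while_exit (Q := fun _ zm' =>
      forall o, (o < n)%N -> zm' o = partial_dft w n x 1 o) _ _ i23 zmE) _ _ => //.
    by rewrite lerDr.
  have fE : M = (M - (M - s))%N by lia.
  rewrite (_ : _ + 1 = (160 * n)%:R + l + 1 + 2); last by ring.
  apply: triple_while_next; first by rewrite i23; lia.
  apply: triple_weaken (triple_stage l wn ssn M0 Ms (dvdnn M) Mn M0 fE regs tab zmE)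
    (lexx _) _ => im' zm' [_ i23' _ zmE'].
  by rewrite divnn M0 in i23' zmE'; apply: triple_while_exit.
have s0 := ltnW s1; have M0 : (0 < M)%N by apply: leq_trans sM.
exists d.+1; first by rewrite expnSr -leq_divRL.
move=> Mn im zm regs i23 tab zmE.
have fE : s = (M - (M - s))%N by lia.
rewrite (_ : _ + 1 = (160 * n)%:R + l +
  (d.+1%:R * ((160 * n)%:R + l + 2) + 1) + 2); last by rewrite -[d.+2%:R]natr1; ring.
apply: triple_while_next; first by rewrite i23; lia.
apply: triple_weaken (triple_stage l wn ssn s0 (leqnn s) sdM Mn M0 fE regs tab zmE)
    (lexx _) _ => im' zm' [regs' i23' tab' zmE'].
by apply: IH => //; apply: dvdn_trans Mn; apply: dvdn_div.
Qed.

Lemma partial_dft_n (x : nat -> R[i]) o : (o < n)%N -> partial_dft w n x n o = x o.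
Proof.
move=> on; have n0 : (0 < n)%N by apply: leq_ltn_trans on.
by rewrite /partial_dft divnn n0 big_ord1 mul0n add0n modn_small// muln0 mul0n mulr1.
Qed.

Lemma triple_fft im zm : splittable s n -> im 0%N = n -> im 1%N = s ->
  zm n = w -> zm n.+1 = 0 ->
  exists2 d, (s ^ d <= n)%N &
  triple s l fft im zm (d.+1%:R * (190 * (n%:R + l)) - 1)
    (fun _ zm' => forall o, (o < n)%N -> zm' o = partial_dft w n zm 1 o).
Proof.
move=> spl i0 i1 zn zn1; have [d dn H] := triple_stages zm spl.
exists d => //; have n4 : (4 <= n)%N by apply: leq_trans ssn; apply: (@leq_mul 2 2).
apply: (@triple_weaken _ _ _ _ _ _ (14 + ((7 * n + 3)%:R + (1 +
  (d.+1%:R * ((160 * n)%:R + l + 2) + 1))))); last by move=> ? ?; apply.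
- apply: triple_seq; apply: triple_weaken (triple_block _ _ _) (lexx _) _.
    by rewrite /setup; run_block.
  move=> im1 zm1 [im1E zm1E]; rewrite i0 in im1E zm1E.
  have regs1 r : (r < 10)%N -> im1 r = nth 0%N (loop_regs n s n) r.
    rewrite im1E; move: r.
    by do 10![case=> [|]; first by rewrite /upd/= ?i0 ?i1//; lia].
  have b1 : im1 21%N = n by rewrite im1E /upd/= addn0.
  have lowz a : a != n.+2 -> zm1 a = zm a.
    by rewrite zm1E !addn1 /upd => /negPf->.
  have one1 : zm1 n.+2 = 1 by rewrite zm1E !addn1 /upd eqxx.
  clear im1E zm1E; apply: triple_seq.
  (* [setup] has stored [w ^+ 0] in cell n + 2, so the loop starts one cell later, with exponent
     1. *)
  apply: triple_weaken (triple_fill s l (b := table_body) (base := n + 3)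
    (good := xpredT) (v := fun e => w ^+ e.+1) _ b1 _) (lexx _) _.
  + by rewrite regs1.
  + move=> im2 zm2 sp2 b2 lt2 out val.
    eexists; eexists; eexists; split.
    * by rewrite /table_body; run_block.
    * by rewrite (sp2 5%N)// (sp2 2%N)// !regs1//=; lia.
    * by do !apply: same_params_upd => //.
    * by [].
    * move=> _; rewrite (sp2 0%N)// (sp2 5%N)// !regs1//=.
      rewrite [X in _ * X](_ : _ = w); last first.
        by rewrite out ?lowz//; lia.
      (* The first iteration reads that 1, every other one the power written just before. *)
      case e20: (im2 20%N) => [|e].
        by rewrite addn0 out ?one1 ?mul1r//; lia.
      rewrite (_ : n.+2 + e.+1 = n + 3 + e)%N; last by lia.
      by rewrite val ?e20// -exprSr.
  + move=> im2 zm2 [sp2 out val].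
    apply: triple_seq; apply: triple_weaken (triple_block _ _ _) (lexx _) _.
      by run_block.
    move=> im3 _ [im3E ->]; apply: H => //.
    * rewrite im3E => r r10; rewrite /upd ltn_eqF; last by lia.
      by rewrite sp2 ?regs1//; lia.
    * by rewrite im3E /upd/= (sp2 4%N)// (sp2 2%N)// !regs1.
    * split; first by rewrite out ?lowz//; lia.
      case=> [|e] en; first by rewrite addn0 out ?one1//; lia.
      rewrite (_ : n.+2 + e.+1 = n + 3 + e)%N; last by lia.
      by rewrite val//; lia.
    * by move=> o on; rewrite partial_dft_n// out ?lowz//; lia.
- have n4R : 4 <= n%:R :> R by rewrite ler_nat.
  have d1 : 1 <= d.+1%:R :> R by rewrite ler1n.
  rewrite [(7 * n + 3)%:R]natrD [(7 * n)%:R]natrM [(160 * n)%:R]natrM.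
  exact: fft_cost_le.
Qed.

End Fft.

(** From [d * ln s <= ln n] and [2 * ln s <= ln n] follows [(d + 1) * 2 * ln s <= 3 * ln n], and
    [2 * ln s] is the logarithm of the base [s ^ 2]. *)
Lemma depth_le_logb (R : realType) (s n d : nat) :
  (1 < s)%N -> (s ^ 2 <= n)%N -> (s ^ d <= n)%N ->
  d.+1%:R <= 3 * logb (s ^ 2)%N%:R n%:R :> R.
Proof.
move=> s1 s2n sdn; have s0 : 0 < s%:R :> R by rewrite ltr0n ltnW.
have n0 : (0 < n)%N by apply: leq_trans s2n; rewrite expn_gt0 ltnW.
have lns : 0 < ln (s%:R : R) by rewrite ln_gt0// ltr1n.
have lnX k : (s ^ k <= n)%N -> k%:R * ln (s%:R : R) <= ln n%:R.
  move=> kn; rewrite mulr_natl -lnXn// -natrX ler_ln ?posrE ?ltr0n ?ler_nat//.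
  by rewrite expn_gt0 ltnW.
rewrite /logb natrX lnXn// mulrA ler_pdivlMr; last by rewrite mulrn_wgt0.
have := lnX _ s2n; have := lnX _ sdn; rewrite -natr1 mulr2n; lra.
Qed.

Theorem theorem7 (R : realType) :
  exists (P : program) (C : R),
    forall (m s n : nat) (l : R) (x : 'cV[R[i]]_n),
      m = (s ^ 2)%N -> (1 < m)%N -> 0 <= l ->
      (m <= n)%N -> splittable s n ->
      exists (t : R) (sg : state R),
        [/\ runs s l P (dft_input s x) t sg,
            output_row n sg = dft x
          & t <= C * ((n%:R + l) * logb m%:R n%:R)].
Proof.
(* 570 is 3 from [depth_le_logb] times 190 from [triple_fft]. *)
exists (compile 0 fft), 570 => m s n l x -> m1 l0 mn spl.
have s1 : (1 < s)%N by move: m1; rewrite expnS expn1; nia.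
have n0 : (0 < n)%N by apply: leq_trans mn; apply: ltnW.
set w := cexp (- (2 * (pi : R)%:C%C * 'i%C / n%:R)).
have wn : w ^+ n = 1 by apply: cexp_unity_root.
pose sg0 := dft_input s x.
have zn : zmem sg0 n = w by rewrite /= insubF ?ltnn// eqxx.
have zn1 : zmem sg0 n.+1 = 0 by rewrite /= insubF ?ltnNge ?leqnSn// gtn_eqF.
have ssn : (s * s <= n)%N by rewrite mulnn.
have [d dn T] := triple_fft wn s1 ssn l0 spl (erefl : imem sg0 0 = n) erefl zn zn1.
have [|t [im [zm [r tB out]]]] := T (compile 0 fft) 0%N; first by move=> j.
exists (t + 1), (State (0 + code_size fft) im zm); split.
(* Past the end of the code, [fetch] returns its default [Halt]. *)
- by apply: reaches_runs r _; rewrite /fetch nth_default// size_compile.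
- apply/rowP => j; rewrite !mxE /= out// /partial_dft divn1.
  apply: eq_bigr => k _; rewrite !mxE modn1 divn1 addn0 muln1 mul1n cexpMn -/w.
  by rewrite /= valK.
- have D := depth_le_logb R s1 mn dn.
  have nl : 0 <= n%:R + l by rewrite addr_ge0.
  apply: (@le_trans _ _ (d.+1%:R * (190 * (n%:R + l)))); first by lra.
  rewrite (_ : 570 * _ = 3 * logb (s ^ 2)%N%:R n%:R * (190 * (n%:R + l))); last by ring.
  by apply: ler_wpM2r => //; lra.
Qed.
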